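(* Let $w\in S_n$, let $C$ be a commutation class of reduced words for $w$, and let $\rho:S_n\to\mathbb N$ be a vote tally with $\operatorname{supp}(\rho)=\operatorname{Pre}(C)$. Regarding the heap poset $P_C$ as a poset on $\operatorname{Inv}(w)$, the $\rho$-tally function $\Sigma_\rho:P_C\to\{1,2,\dots\}$ is strictly decreasing: $ab<_{P_C}cd$ implies $\Sigma_\rho(ab)>\Sigma_\rho(cd)$. Furthermore, the sets $\{ab\in\operatorname{Inv}(w):\Sigma_\rho(ab)>\tfrac12|\rho|\}$ and $\{ab\in\operatorname{Inv}(w):\Sigma_\rho(ab)\ge\tfrac12|\rho|\}$ are order ideals of $P_C$, there are unique $u,v\in\operatorname{Pre}(C)$ with $\operatorname{Inv}(u)$ equal to the first set and $\operatorname{Inv}(v)$ equal to the second, and the majority relation $\triangleleft_\rho$, viewed as a subset of $[n]\times[n]$, equals the intersection of the linear orders $<_u$ and $<_v$.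
   Context: For $w=(w_1,\dots,w_n)\in S_n$, $<_w$ denotes the linear order $w_1<_w\cdots<_w w_n$ on $[n]$, and $\operatorname{Inv}(w)=\{(a,b):1\le a<b\le n,\ b<_w a\}$, pairs written $ab$. Let $s_i$ be the adjacent transposition of $i,i+1$; $ws_i$ is obtained from $w$ by swapping the entries in positions $i,i+1$. A reduced word for $w$ is $(i_1,\dots,i_\ell)$ with $w=s_{i_1}\cdots s_{i_\ell}$, $\ell=|\operatorname{Inv}(w)|$. The commutation class $C(\mathbf i)$ is the set of words obtained from $\mathbf i$ by repeatedly swapping adjacent entries differing by at least $2$. $\operatorname{Pre}(C)$ is the set of all $s_{i'_1}\cdots s_{i'_m}$ ($0\le m\le\ell$) with $(i'_1,\dots,i'_m)$ a prefix of a word in $C$. The heap poset $P_C$ on $\operatorname{Inv}(w)$: fix $\mathbf i=(i_1,\dots,i_\ell)\in C$, let $x_j$ be the unique element of $\operatorname{Inv}(s_{i_1}\cdots s_{i_j})\setminus\operatorname{Inv}(s_{i_1}\cdots s_{i_{j-1}})$; $P_C$ is the transitive closure of the relations $x_j<x_k$ for $j<k$ with $|i_j-i_k|\le 1$ (independent of the choice of $\mathbf i\in C$). A vote tally is $\rho:S_n\to\mathbb N$, $|\rho|=\sum_{w}\rho(w)$, $\operatorname{supp}(\rho)=\{w:\rho(w)>0\}$; majority relation: $a\triangleleft_\rho b$ iff $\sum_{w:\,a<_wb}\rho(w)>\sum_{w:\,b<_wa}\rho(w)$. The $\rho$-tally function is $\Sigma_\rho(ab)=\sum_{w'\in\operatorname{Pre}(C):\,ab\in\operatorname{Inv}(w')}\rho(w')$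 for $ab\in\operatorname{Inv}(w)$. *)

(* Defs.v *)
(* [n] is 'I_n, so values, positions and the letters i of s_i are numbered from
   0 instead of 1; one-line notation is w = (w 0, ..., w (n-1)). *)
From Stdlib Require Export Relation_Operators.
From mathcomp Require Export all_boot all_fingroup.
From mathcomp Require Export ssralg ssrnum ssrint.
Export IntDist.

Set Implicit Arguments.
Unset Strict Implicit.
Unset Printing Implicit Defensive.

(* a <_w b: the entry a stands to the left of the entry b in one-line notation *)
Definition wlt n (w : 'S_n) (a b : 'I_n) : bool := (w^-1)%g a < (w^-1)%g b.

Definition linear_order n (w : 'S_n) : {set 'I_n * 'I_n} :=
  [set p : 'I_n * 'I_n | wlt w p.1 p.2].

Definition Inv n (w : 'S_n) : {set 'I_n * 'I_n} :=
  [set p : 'I_n * 'I_n | (p.1 < p.2) && wlt w p.2 p.1].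

Lemma letter_lt n (i : 'I_n.-1) : i < n.
Proof. exact: leq_trans (ltn_ord i) (leq_pred n). Qed.

Lemma letterS_lt n (i : 'I_n.-1) : i.+1 < n.
Proof. by rewrite -ltn_predRL. Qed.

Definition adj_transp n (i : 'I_n.-1) : 'S_n :=
  tperm (Ordinal (letter_lt i)) (Ordinal (letterS_lt i)).

(* s_{i_1} ... s_{i_m}, with the product of permutations being the composition
   of functions, so that u s_i swaps the entries of u in positions i and i+1.
   The product of {perm T} composes the other way, (s * u) x = u (s x), hence
   u s_i is written adj_transp i * u. *)
Definition word_perm n (s : seq 'I_n.-1) : 'S_n :=
  foldl (fun u i => adj_transp i * u)%g 1%g s.

Definition reduced_words n (w : 'S_n) : {set #|Inv w|.-tuple 'I_n.-1} :=
  [set i : #|Inv w|.-tuple 'I_n.-1 | word_perm i == w].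

Definition comm_step n l (i i' : l.-tuple 'I_n.-1) : bool :=
  [exists j : 'I_l, exists k : 'I_l,
     [&& k == j.+1 :> nat, 2 <= `|tnth i j - tnth i k|
       & i' == [tuple tnth i (tperm j k h) | h < l]]].

Definition comm_class n l (i : l.-tuple 'I_n.-1) : {set l.-tuple 'I_n.-1} :=
  [set i' | connect (@comm_step n l) i i'].

Definition comm_classes n (w : 'S_n) : {set {set #|Inv w|.-tuple 'I_n.-1}} :=
  [set comm_class i | i in reduced_words w].

Definition Pre n l (C : {set l.-tuple 'I_n.-1}) : {set 'S_n} :=
  [set word_perm (take m i) | i : l.-tuple 'I_n.-1 in C, m : 'I_l.+1 in 'I_l.+1].

(* p is the element x_j attached to the j-th letter of the word i: the unique
   inversion created by that letter *)
Definition is_heap_elt n l (i : l.-tuple 'I_n.-1) (j : 'I_l)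
    (p : 'I_n * 'I_n) : bool :=
  Inv (word_perm (take j.+1 i)) :\: Inv (word_perm (take j i)) == [set p].

Definition heap_gen n l (i : l.-tuple 'I_n.-1) (p q : 'I_n * 'I_n) : Prop :=
  exists j k : 'I_l, [/\ j < k, `|tnth i j - tnth i k| <= 1,
                         is_heap_elt i j p & is_heap_elt i k q].

(* The strict order of P_C, computed from a word i of C. *)
Definition heap_lt n l (i : l.-tuple 'I_n.-1) (p q : 'I_n * 'I_n) : Prop :=
  clos_trans _ (heap_gen i) p q.

Definition heap_ideal n (w : 'S_n) (i : #|Inv w|.-tuple 'I_n.-1)
    (I : {set 'I_n * 'I_n}) : Prop :=
  I \subset Inv w /\ (forall p q, heap_lt i p q -> q \in I -> p \in I).

Definition total_votes n (rho : 'S_n -> nat) : nat := \sum_w rho w.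

Definition supp n (rho : 'S_n -> nat) : {set 'S_n} := [set w | 0 < rho w].

Definition majority n (rho : 'S_n -> nat) : {set 'I_n * 'I_n} :=
  [set p : 'I_n * 'I_n | \sum_(w | wlt w p.2 p.1) rho w < \sum_(w | wlt w p.1 p.2) rho w].

Definition tally n l (C : {set l.-tuple 'I_n.-1}) (rho : 'S_n -> nat)
    (p : 'I_n * 'I_n) : nat :=
  \sum_(w' in Pre C | p \in Inv w') rho w'.

(* Thresholds |rho|/2, with the denominator cleared. *)
Definition above_half n (w : 'S_n) (C : {set #|Inv w|.-tuple 'I_n.-1})
    (rho : 'S_n -> nat) : {set 'I_n * 'I_n} :=
  [set p : 'I_n * 'I_n in Inv w | total_votes rho < 2 * tally C rho p].

Definition at_least_half n (w : 'S_n) (C : {set #|Inv w|.-tuple 'I_n.-1})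
    (rho : 'S_n -> nat) : {set 'I_n * 'I_n} :=
  [set p : 'I_n * 'I_n in Inv w | total_votes rho <= 2 * tally C rho p].

(* Main.v *)
(** The inversion sets of the elements of [Pre C] are exactly the order ideals of
    the heap: commutation moves preserve the heap, so a prefix of a word of [C]
    gives an ideal, and conversely a word can be sorted by commutations so that
    the letters of a given ideal come first.  If [p < q] in the heap, every
    element of [Pre C] inverting [q] inverts [p], and some prefix of the word
    inverts [p] but not [q]; hence the tally strictly decreases and its upper
    level sets are ideals, so they are the inversion sets of [u] and [v].  For
    [a < b], the tally of [ab] is the number of votes placing [b] before [a],
    and comparing it with half of the total gives the majority relation. *)

Require Import Defs.
From mathcomp Require Import zify.

Set Implicit Arguments.
Unset Strict Implicit.
Unset Printing Implicit Defensive.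

(** * Inversion sets determine permutations *)

Lemma wlt_asym n (u : 'S_n) a b : a != b -> wlt u a b = ~~ wlt u b a.
Proof.
move=> ab; rewrite /wlt -leqNgt ltn_neqAle.
by rewrite -(inj_eq (@perm_inj _ (u^-1)%g)) -val_eqE in ab; rewrite ab.
Qed.

Lemma wlt_irr n (u : 'S_n) a : wlt u a a = false.
Proof. by rewrite /wlt ltnn. Qed.

Lemma mem_Inv_wlt n (u : 'S_n) (a b : 'I_n) : a < b -> ((a, b) \in Inv u) = wlt u b a.
Proof. by move=> ab; rewrite inE /= ab. Qed.

(** The entries to the left of [a] fill the positions below that of [a]; so the order [wlt u]
    determines every position, hence [u]. *)
Lemma card_wlt n (u : 'S_n) a : #|[set b | wlt u b a]| = (u^-1)%g a.
Proof.
rewrite -(card_imset _ (@perm_inj _ (u^-1)%g)).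
have -> : [set (u^-1)%g x | x in [set b | wlt u b a]]
          = [set k : 'I_n | k < (u^-1)%g a].
  apply/setP=> k; rewrite inE; apply/imsetP/idP=> [[x] | lt_k].
    by rewrite inE => ? ->.
  by exists (u k); rewrite ?inE /wlt ?permK.
(* The count over ['I_n] becomes one over [iota 0 n], which is split at the position of [a]: all of
   the first block is kept and none of the second. *)
rewrite cardsE cardE size_filter.
rewrite -(count_map val (fun k => k < (u^-1)%g a)) -enumT val_enum_ord.
rewrite -size_filter -[X in filter _ (iota 0 X)](subnKC (ltnW (ltn_ord ((u^-1)%g a)))).
rewrite iotaD filter_cat size_cat add0n.
rewrite (@eq_in_filter _ _ predT) ?filter_predT ?size_iota; last first.
  by move=> k; rewrite mem_iota.
rewrite (@eq_in_filter _ _ pred0) ?filter_pred0 ?addn0 //.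
by move=> k; rewrite mem_iota => /andP[ge_k _]; apply/negbTE; rewrite -leqNgt.
Qed.

(** By asymmetry the inversions fix the relative order of every pair of values, and [card_wlt] turns
    the order into positions. This gives the uniqueness of the two ideals' permutations. *)
Lemma Inv_inj n : injective (@Inv n).
Proof.
move=> u v eq_uv; apply: invg_inj; apply/permP=> a; apply: val_inj => /=.
rewrite -!card_wlt; congr #|pred_of_set _|; apply/setP=> b; rewrite !inE.
case: (ltngtP b a) => [lt_ba|lt_ab|/val_inj->]; last by rewrite !wlt_irr.
  have ba: b != a by rewrite -val_eqE /= ltn_eqF.
  by rewrite !(wlt_asym _ ba) -!(mem_Inv_wlt _ lt_ba) eq_uv.
by rewrite -!(mem_Inv_wlt _ lt_ab) eq_uv.
Qed.

(** * Words read letter by letter, and the inversions they create *)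

Definition crossed n (u : 'S_n) (i : 'I_n.-1) : 'I_n * 'I_n :=
  (u (Ordinal (letter_lt i)), u (Ordinal (letterS_lt i))).

(** [word_perm] is the case [u = 1]; an arbitrary starting point makes induction on the word
    possible. *)
Definition run n (u : 'S_n) (s : seq 'I_n.-1) : 'S_n :=
  foldl (fun u i => adj_transp i * u)%g u s.

(* The letters of [s], each with the pair of values it exchanges, starting from
   [u]; for a reduced word and [u = 1] the pairs are the heap elements [x_j]. *)
Fixpoint trace n (u : 'S_n) (s : seq 'I_n.-1) : seq ('I_n.-1 * ('I_n * 'I_n)) :=
  if s is i :: s' then (i, crossed u i) :: trace (adj_transp i * u)%g s' else [::].

(** [crossed] lists its pair by position, so increasing values mean that the letter creates an
    inversion instead of removing one. *)
Definition ascending n (x : 'I_n.-1 * ('I_n * 'I_n)) : bool := x.2.1 < x.2.2.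

Lemma crossed_adj n (u : 'S_n) i :
  crossed (adj_transp i * u)%g i = ((crossed u i).2, (crossed u i).1).
Proof. by rewrite /crossed !permM tpermL tpermR. Qed.

Lemma adj_transp_val n (i : 'I_n.-1) (z : 'I_n) :
  adj_transp i z = (if z == i :> nat then i.+1
                    else if z == i.+1 :> nat then (i : nat) else z) :> nat.
Proof.
rewrite /adj_transp; case: tpermP => [->|->|] /=.
- by rewrite eqxx.
- by rewrite eqxx gtn_eqF.
- by move=> /eqP; rewrite -val_eqE /= => /negbTE-> /eqP;
     rewrite -val_eqE /= => /negbTE->.
Qed.

Lemma wlt_adj n (u : 'S_n) i a b :
  wlt (adj_transp i * u)%g a b =
  if (a, b) == crossed u i then false
  else if (b, a) == crossed u i then true else wlt u a b.
Proof.
rewrite /wlt invMg tpermV !permM /crossed !xpair_eqE.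
rewrite -!(can2_eq (permKV u) (permK u)) -!val_eqE /= !adj_transp_val.
move: (nat_of_ord _) (nat_of_ord _) (nat_of_ord _) => x k y.
by do !case: eqP => //=; lia.
Qed.

Lemma mem_Inv_adj n (u : 'S_n) i p : ascending (i, crossed u i) ->
  p \in Inv (adj_transp i * u)%g = (p == crossed u i) || (p \in Inv u).
Proof.
case: p => a b asc; have {asc} : (crossed u i).1 < (crossed u i).2 by [].
rewrite !inE wlt_adj; case: (crossed u i) => x y /= lt_xy; rewrite !xpair_eqE.
have yx : y == x = false by rewrite -val_eqE gtn_eqF.
have [/andP[/eqP-> /eqP->]|_] := boolP ((b == x) && (a == y)).
  by rewrite yx andbF ltnNge (ltnW lt_xy).
by have [/andP[/eqP-> /eqP->]|_] := boolP ((a == x) && (b == y)); rewrite ?lt_xy.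
Qed.

Lemma crossed_notin n (u : 'S_n) i : crossed u i \notin Inv u.
Proof. by rewrite inE /crossed /wlt /= !permK /= [X in _ && X]ltnNge leqnSn andbF. Qed.

Lemma crossed_neq n (u : 'S_n) i : (crossed u i).1 != (crossed u i).2.
Proof. by rewrite (inj_eq perm_inj) -val_eqE /= ltn_eqF. Qed.

Lemma card_Inv_adj n (u : 'S_n) i :
  #|Inv (adj_transp i * u)%g| <= #|Inv u| + ascending (i, crossed u i).
Proof.
have up v : ascending (i, crossed v i) ->
    Inv (adj_transp i * v)%g = crossed v i |: Inv v.
  by move=> asc; apply/setP=> p; rewrite mem_Inv_adj // in_setU1.
case: (boolP (ascending _)) => [asc|desc].
  by rewrite up // cardsU1 crossed_notin addnC.
(* In the descending case [u] is itself obtained from the swapped permutation by an ascending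
   letter, since [adj_transp i] is an involution. *)
rewrite addn0; apply: subset_leq_card; apply/subsetP=> p pu.
have -> : u = (adj_transp i * (adj_transp i * u))%g.
  by rewrite mulgA tperm2 mul1g.
rewrite mem_Inv_adj ?pu ?orbT //.
move: desc; rewrite /ascending crossed_adj /= -leqNgt ltn_neqAle => ->.
by rewrite val_eqE eq_sym crossed_neq.
Qed.

Lemma card_Inv_run n (u : 'S_n) s : #|Inv (run u s)| <= #|Inv u| + size s.
Proof.
elim: s u => [|i s IH] u /=; first by rewrite addn0.
apply: leq_trans (IH _) _; rewrite -addSnnS leq_add2r.
by apply: leq_trans (card_Inv_adj u i) _; rewrite -addn1 leq_add2l leq_b1.
Qed.

(** Each letter adds at most one inversion, so reaching the maximal number forces every letter to
    add one. *)
Lemma trace_ascending n (u : 'S_n) s :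
  #|Inv (run u s)| = #|Inv u| + size s -> all (@ascending n) (trace u s).
Proof.
elim: s u => [|i s IH] u //= eq_card.
have := card_Inv_run (adj_transp i * u)%g s; rewrite eq_card.
have := card_Inv_adj u i; case: (boolP (ascending _)) => /= asc le1 le2; last by lia.
apply: IH; rewrite [LHS]eq_card; apply/eqP.
by rewrite eqn_leq le2 -addSnnS leq_add2r -addn1.
Qed.

Lemma mem_Inv_run n (u : 'S_n) s p : all (@ascending n) (trace u s) ->
  p \in Inv (run u s) = (p \in Inv u) || (p \in map snd (trace u s)).
Proof.
elim: s u => [|i s IH] u /=; first by rewrite orbF.
by case/andP=> asc ascs; rewrite IH // mem_Inv_adj // inE orbCA orbA.
Qed.

Lemma size_trace n (u : 'S_n) s : size (trace u s) = size s.
Proof. by elim: s u => //= i s IH u; rewrite IH. Qed.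

Lemma trace_cat n (u : 'S_n) s1 s2 :
  trace u (s1 ++ s2) = trace u s1 ++ trace (run u s1) s2.
Proof. by elim: s1 u => //= i s IH u; rewrite IH. Qed.

Lemma run_cat n (u : 'S_n) s1 s2 : run u (s1 ++ s2) = run (run u s1) s2.
Proof. exact: foldl_cat. Qed.

Lemma trace_take n (u : 'S_n) m s : trace u (take m s) = take m (trace u s).
Proof. by elim: s u m => [|i s IH] u [|m] //=; rewrite IH. Qed.

Lemma map_fst_trace n (u : 'S_n) s : map fst (trace u s) = s.
Proof. by elim: s u => //= i s IH u; rewrite IH. Qed.

(** Inversions persist along ascending letters, and a letter never crosses a pair that it meets as
    an inversion already listed in this order. *)
Lemma trace_fresh n (u : 'S_n) s p : all (@ascending n) (trace u s) ->
  p \in Inv u -> p \notin map snd (trace u s).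
Proof.
elim: s u => [|i s IH] u //= /andP[asc ascs] pu.
rewrite inE negb_or IH ?mem_Inv_adj ?pu ?orbT // andbT.
by apply: contraTneq pu => ->; apply: crossed_notin.
Qed.

Lemma trace_uniq n (u : 'S_n) s : all (@ascending n) (trace u s) ->
  uniq (map snd (trace u s)).
Proof.
elim: s u => [|i s IH] u //= /andP[asc ascs]; rewrite IH // andbT.
by apply: trace_fresh; rewrite ?mem_Inv_adj ?eqxx.
Qed.

(** * Commutation moves, their effect on traces, and sorting by an ideal *)

Variant comm_swap n : seq 'I_n.-1 -> seq 'I_n.-1 -> Prop :=
  CommSwap s1 (a b : 'I_n.-1) s2 of 2 <= `|a - b| :
    comm_swap (s1 ++ a :: b :: s2) (s1 ++ b :: a :: s2).

Definition comm_equiv n := clos_refl_trans _ (@comm_swap n).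

Lemma comm_swap_sym n s s' : @comm_swap n s s' -> comm_swap s' s.
Proof. by case=> s1 a b s2 ab; constructor; rewrite distnC. Qed.

Lemma comm_equiv_cons n a s s' :
  comm_equiv s s' -> @comm_equiv n (a :: s) (a :: s').
Proof.
elim=> [_ _ [s1 b c s2 bc]|s0|s1 s2 s3 _ e12 _ e23].
- by apply: rt_step; rewrite -!cat_cons; constructor.
- exact: rt_refl.
- exact: rt_trans e12 e23.
Qed.

Lemma comm_equiv_shift n (a : 'I_n.-1) s1 s2 :
  all (fun b : 'I_n.-1 => 2 <= `|a - b|) s1 ->
  comm_equiv (a :: s1 ++ s2) (s1 ++ a :: s2).
Proof.
elim: s1 => [|b s1 IH] /=; first by move=> _; apply: rt_refl.
case/andP=> ab /IH e; apply: rt_trans (comm_equiv_cons b e).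
by apply: rt_step; apply: (@CommSwap n [::]).
Qed.

Lemma distn_ge2P (m k : nat) : 2 <= `|m - k| ->
  [&& m != k, m.+1 != k & m != k.+1].
Proof. lia. Qed.

Lemma adj_transp_commute n (u : 'S_n) (a b : 'I_n.-1) : 2 <= `|a - b| ->
  (adj_transp a * (adj_transp b * u) = adj_transp b * (adj_transp a * u))%g.
Proof.
move=> /distn_ge2P/and3P[n1 n2 n3].
rewrite !mulgA; congr (_ * u)%g; rewrite conjgC; congr (_ * _)%g.
by rewrite tpermJ !tpermD // -val_eqE //= eq_sym.
Qed.

Lemma crossed_far n (u : 'S_n) (a b : 'I_n.-1) : 2 <= `|a - b| ->
  crossed (adj_transp a * u)%g b = crossed u b.
Proof.
move=> /distn_ge2P/and3P[n1 n2 n3].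
by rewrite /crossed !permM !tpermD // -val_eqE.
Qed.

(** Letters at distance at least 2 act on disjoint positions, so neither changes the pair crossed by
    the other: the two trace entries just trade places. *)
Lemma trace_comm_swap n (u : 'S_n) s s' : comm_swap s s' ->
  [/\ run u s = run u s' &
    exists t1 x y t2, [/\ trace u s = t1 ++ x :: y :: t2,
      trace u s' = t1 ++ y :: x :: t2 & 2 <= `|x.1 - y.1|]].
Proof.
case=> s1 a b s2 ab; have ba : 2 <= `|b - a| by rewrite distnC.
rewrite !run_cat !trace_cat /= (adj_transp_commute _ ab); split=> //.
exists (trace u s1), (a, crossed (run u s1) a), (b, crossed (run u s1) b).
by eexists; rewrite !crossed_far.
Qed.

(** Imposed through [pairwise] on a trace, this says that [P] is closed downwards under the
    generating relations of the heap; [pairwise] supplies the condition that [x] comes before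
    [y]. *)
Definition heap_closed n (P : pred ('I_n * 'I_n)) (x y : 'I_n.-1 * ('I_n * 'I_n)) :=
  (`|x.1 - y.1| <= 1) ==> P y.2 ==> P x.2.

(** The only two entries whose order changes have letters at distance at least 2, for which the
    condition is vacuous. *)
Lemma heap_closed_swap n (u : 'S_n) P s s' : comm_swap s s' ->
  pairwise (heap_closed P) (trace u s) -> pairwise (heap_closed P) (trace u s').
Proof.
case/(trace_comm_swap u)=> _ [t1 [x [y [t2 [-> -> xy]]]]].
have yx : heap_closed P y x.
  by rewrite /heap_closed [X in X ==> _](_ : _ = false) // distnC leqNgt xy.
rewrite !pairwise_cat /= => /and3P[r12 -> /and3P[/andP[_ xt] yt ->]].
rewrite yx yt xt /= !andbT.
by move: r12; rewrite !(allrel_consr, allrel_consl) => /and3P[-> -> ->].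
Qed.

Lemma trace_shift n (u : 'S_n) (a : 'I_n.-1) s :
  all (fun b : 'I_n.-1 => 2 <= `|a - b|) s ->
  [/\ trace (adj_transp a * u)%g s = trace u s,
      crossed (run u s) a = crossed u a
    & (adj_transp a * run u s)%g = run (adj_transp a * u)%g s].
Proof.
elim: s u => [|b s IH] u //= /andP[ab /IH far].
have [e1 e2 e3] := far (adj_transp b * u)%g.
by rewrite crossed_far // e2 e3 crossed_far 1?distnC // -adj_transp_commute // e1.
Qed.

(* Moving the elements satisfying [P] to the front crosses only letters that
   are at distance at least 2, as [P] is closed downwards. *)
Lemma heap_closed_partition n (u : 'S_n) P s :
  pairwise (heap_closed P) (trace u s) ->
  let t := trace u s in
  exists2 s', comm_equiv s s' &
    trace u s' = filter (P \o snd) t ++ filter (predC (P \o snd)) t.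
Proof.
elim: s u => [|a s IH] u /=; first by exists [::] => //; apply: rt_refl.
case/andP=> closed_a /IH[s' ss' ts'].
case: ifP => /= Pa; first by exists (a :: s'); [apply: comm_equiv_cons | rewrite /= ts'].
set t := trace _ s in closed_a ts' *.
set t1 := filter _ t in ts' *; set t2 := filter (predC _) t in ts' *.
(* The pair crossed by [a] fails [P], so [a] has to move past [s1], the letters of [s'] whose pairs
   satisfy [P]. *)
pose s1 := take (size t1) s'; pose s2 := drop (size t1) s'.
have ts1 : trace (adj_transp a * u)%g s1 = t1 by rewrite trace_take ts' take_size_cat.
have ts2 : trace (run (adj_transp a * u)%g s1) s2 = t2.
  have := trace_cat (adj_transp a * u)%g s1 s2.
  by rewrite cat_take_drop ts' ts1 => /eqP; rewrite eqseq_cat // eqxx => /eqP.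
(* A letter of [s1] near [a] would, by closure, force [P] on the pair crossed by [a]. *)
have far : all (fun b : 'I_n.-1 => 2 <= `|a - b|) s1.
  rewrite -(map_fst_trace (adj_transp a * u)%g s1) ts1 all_map.
  apply/allP=> y; rewrite mem_filter => /andP[Py /(allP closed_a)].
  by rewrite /heap_closed /= Pa [P y.2]Py /= implybF -ltnNge.
have [e1 e2 e3] := trace_shift u far.
exists (s1 ++ a :: s2).
  apply: rt_trans (comm_equiv_shift _ far).
  by apply: comm_equiv_cons; rewrite cat_take_drop.
by rewrite trace_cat /= -e1 ts1 e2 e3 ts2.
Qed.

(** * Commutation steps on tuples and moves on sequences *)

Lemma nth_swap (T : Type) (x0 : T) s1 a b s2 h :
  nth x0 (s1 ++ b :: a :: s2) h =
  if h == size s1 then b else if h == (size s1).+1 then a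
  else nth x0 (s1 ++ a :: b :: s2) h.
Proof.
rewrite !nth_cat; case: (ltngtP h (size s1)) => [lt_h|gt_h|->].
- by rewrite ltn_eqF // ltnS ltnW.
- rewrite -(subnKC gt_h) addSnnS addKn -addSnnS -[X in _ == X]addn0 eqn_add2l.
  by case: (h - _).
- by rewrite subnn.
Qed.

Lemma comm_stepP n l (i i' : l.-tuple 'I_n.-1) :
  comm_step i i' <-> comm_swap i i'.
Proof.
split.
  case/existsP=> j /existsP[k /and3P[/eqP kj far /eqP ->]].
  have lt_ki : k < size i by rewrite size_tuple.
  have lt_ji : j < size i by rewrite size_tuple.
  have x0 := tnth i j.
  have ei : i = take j i ++ tnth i j :: tnth i k :: drop k.+1 i :> seq _.
    by rewrite !(tnth_nth x0) -drop_nth // kj -drop_nth // cat_take_drop.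
  rewrite [X in comm_swap X]ei.
  have -> : [tuple tnth i (tperm j k h) | h < l] =
      take j i ++ tnth i k :: tnth i j :: drop k.+1 i :> seq _.
    apply: (@eq_from_nth _ x0).
      by rewrite size_tuple; have := congr1 size ei; rewrite size_tuple !size_cat.
    rewrite size_tuple => h lt_hl.
    have -> : h = Ordinal lt_hl by [].
    rewrite -tnth_nth tnth_mktuple nth_swap -ei size_takel ?(ltnW lt_ji) //.
    rewrite -kj !val_eqE; case: tpermP => [->|->|].
    - by rewrite eqxx.
    - by rewrite eqxx -val_eqE /= kj gtn_eqF.
    - by move=> /eqP/negbTE-> /eqP/negbTE->; rewrite (tnth_nth x0).
  by constructor.
(* The underlying sequences are generalized, with their equations kept, so that [comm_swap] can be
   inverted. *)
move: {2 3}(tval i) {2 3}(tval i') (erefl (tval i)) (erefl (tval i')) => s s' es es' st.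
case: st es es' => s1 a b s2 far es es'.
have lt_j : size s1 < l by rewrite -(size_tuple i) es size_cat /=; lia.
have lt_k : (size s1).+1 < l by rewrite -(size_tuple i) es size_cat /=; lia.
apply/existsP; exists (Ordinal lt_j); apply/existsP; exists (Ordinal lt_k).
have ta : tnth i (Ordinal lt_j) = a.
  by rewrite (tnth_nth a) es /= nth_cat ltnn subnn.
have tb : tnth i (Ordinal lt_k) = b.
  by rewrite (tnth_nth a) es /= nth_cat ltnNge leqnSn subSnn.
rewrite ta tb far eqxx /=; apply/eqP/eq_from_tnth => h.
rewrite tnth_mktuple [tnth i' h](tnth_nth a) es' nth_swap -es; case: tpermP => [->|->|].
- by rewrite /= eqxx tb.
- by rewrite /= eqxx gtn_eqF ?ta.
- move=> /eqP; rewrite -val_eqE /= => /negbTE-> /eqP.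
  by rewrite -val_eqE /= => /negbTE->; rewrite (tnth_nth a).
Qed.

Lemma comm_step_sym n l : symmetric (@comm_step n l).
Proof.
by move=> i i'; apply/idP/idP=> /comm_stepP/comm_swap_sym/comm_stepP.
Qed.

Lemma connect_comm_equiv n l (i i' : l.-tuple 'I_n.-1) :
  connect (@comm_step n l) i i' -> comm_equiv i i'.
Proof.
case/connectP=> p; elim: p i => [|i1 p IH] i /= => [_ ->|]; first exact: rt_refl.
case/andP=> /comm_stepP st pth e; apply: rt_trans (IH _ pth e); exact: rt_step.
Qed.

Lemma comm_equiv_connect n l s s' (i : l.-tuple 'I_n.-1) :
  comm_equiv s s' -> s = i ->
  exists2 i' : l.-tuple 'I_n.-1, s' = i' & connect (@comm_step n l) i i'.
Proof.
move=> e; elim: e i => [s1 s2 st|s1|s1 s2 s3 _ IH1 _ IH2] i ei.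
- have sz : size s2 == l.
    by move: ei; case: st => ? ? ? ? _ ei; rewrite -(size_tuple i) -ei !size_cat.
  by exists (Tuple sz) => //; apply: connect1; apply/comm_stepP; rewrite -ei.
- by exists i.
- have [i2 e2 c2] := IH1 _ ei; have [i3 e3 c3] := IH2 _ e2.
  by exists i3 => //; apply: connect_trans c2 c3.
Qed.

Lemma run_comm_equiv n (u : 'S_n) s s' : comm_equiv s s' -> run u s = run u s'.
Proof.
by elim=> [s1 s2 /(trace_comm_swap u)[]|//|s1 s2 s3 _ -> _ ->].
Qed.

Lemma heap_closed_equiv n (u : 'S_n) P s s' : comm_equiv s s' ->
  pairwise (heap_closed P) (trace u s) -> pairwise (heap_closed P) (trace u s').
Proof.
by elim=> [s1 s2 /heap_closed_swap|//|s1 s2 s3 _ e1 _ e2 /e1/e2]; [apply|].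
Qed.

(** * The heap of a reduced word, read from its trace *)

Lemma Inv1 n : Inv (1 : 'S_n)%g = set0.
Proof.
apply/setP=> -[a b]; rewrite !inE /wlt invg1 !perm1 /=.
by apply/negbTE; rewrite negb_and -!leqNgt leq_total.
Qed.

Lemma reduced_ascending n (w : 'S_n) (i : #|Inv w|.-tuple 'I_n.-1) :
  word_perm i = w -> all (@ascending n) (trace 1%g i).
Proof.
move=> ew; apply: trace_ascending.
by rewrite [run _ _]ew Inv1 cards0 size_tuple.
Qed.

Lemma mem_Inv_word n (s : seq 'I_n.-1) p : all (@ascending n) (trace 1%g s) ->
  (p \in Inv (word_perm s)) = (p \in map snd (trace 1%g s)).
Proof. by move=> asc; rewrite mem_Inv_run // Inv1 inE. Qed.

Lemma mem_Inv_take n (s : seq 'I_n.-1) m p : all (@ascending n) (trace 1%g s) ->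
  (p \in Inv (word_perm (take m s))) = (p \in take m (map snd (trace 1%g s))).
Proof.
move=> asc; rewrite mem_Inv_word trace_take ?map_take //.
by rewrite -(cat_take_drop m (trace _ s)) all_cat in asc; case/andP: asc.
Qed.

(** The pairs in the trace of a reduced word are distinct, so each occurs at index [j] only. *)
Lemma nth_mem_Inv_take n (s : seq 'I_n.-1) m j p0 :
  all (@ascending n) (trace 1%g s) -> j < size s ->
  (nth p0 (map snd (trace 1%g s)) j \in Inv (word_perm (take m s))) = (j < m).
Proof.
move=> asc lt_j; rewrite mem_Inv_take //.
have sz : j < size (map snd (trace 1%g s)) by rewrite size_map size_trace.
by rewrite in_take ?mem_nth // index_uniq // trace_uniq.
Qed.

Lemma is_heap_eltE n l (i : l.-tuple 'I_n.-1) (j : 'I_l) p p0 :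
  all (@ascending n) (trace 1%g i) ->
  is_heap_elt i j p = (p == nth p0 (map snd (trace 1%g i)) j).
Proof.
move=> asc; rewrite /is_heap_elt.
have -> : Inv (word_perm (take j.+1 i)) :\: Inv (word_perm (take j i)) =
    [set nth p0 (map snd (trace 1%g i)) j].
  have lt_j : j < size (map snd (trace 1%g i)).
    by rewrite size_map size_trace size_tuple.
  apply/setP=> q; rewrite in_setD !mem_Inv_take // in_set1.
  rewrite (take_nth p0) // mem_rcons in_cons.
  case: eqP => [->|_]; last by case: (_ \in _).
  by rewrite andbT in_take ?mem_nth // index_uniq ?trace_uniq // ltnn.
by rewrite (inj_eq set1_inj) eq_sym.
Qed.

(** Restates closure under the heap of [i] as a condition on the trace, a form that can be carried
    along commutation moves. *)
Lemma heap_genP n l (i : l.-tuple 'I_n.-1) (P : pred ('I_n * 'I_n)) :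
  all (@ascending n) (trace 1%g i) ->
  (forall p q, heap_gen i p q -> P q -> P p) <->
  pairwise (heap_closed P) (trace 1%g i).
Proof.
move=> asc; have sz : size (trace 1%g i) = l by rewrite size_trace size_tuple.
have fstE x0 (j : 'I_l) : (nth x0 (trace 1%g i) j).1 = tnth i j.
  by rewrite (tnth_nth x0.1) -{2}(map_fst_trace 1%g i) (nth_map x0) ?sz.
have sndE x0 (j : 'I_l) :
    nth x0.2 (map snd (trace 1%g i)) j = (nth x0 (trace 1%g i) j).2.
  by rewrite (nth_map x0) ?sz.
split=> [closed|].
  case et: (trace 1%g i) => [//|x0 t]; rewrite -et.
  apply/(pairwiseP x0) => j k; rewrite !inE sz => lt_j lt_k lt_jk.
  rewrite /heap_closed (fstE x0 (Ordinal lt_j)) (fstE x0 (Ordinal lt_k)).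
  apply/implyP=> near; apply/implyP; apply: closed.
  exists (Ordinal lt_j), (Ordinal lt_k).
  by rewrite !(@is_heap_eltE _ _ _ _ _ x0.2) // !sndE; split.
move=> closed p q [j [k [lt_jk near]]].
pose x0 := (tnth i j, crossed 1%g (tnth i j)).
rewrite !(@is_heap_eltE _ _ _ _ _ x0.2) // !sndE => /eqP-> /eqP->.
move/(pairwiseP x0): closed => /(_ j k); rewrite !inE sz !ltn_ord => /(_ isT isT lt_jk).
by rewrite /heap_closed !fstE near /= => /implyP.
Qed.

(** The prefix ending with the letter of [p], of length [j.+1], stops before the letter of [q]; its
    vote makes the tally decrease strictly. *)
Lemma heap_gen_lt n l (i : l.-tuple 'I_n.-1) p q :
  all (@ascending n) (trace 1%g i) -> heap_gen i p q ->
  exists2 j : 'I_l, p \in Inv (word_perm (take j.+1 i)) &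
                    q \notin Inv (word_perm (take j.+1 i)).
Proof.
move=> asc [j [k [lt_jk _ hp hq]]]; exists j.
  move: hp; rewrite (@is_heap_eltE _ _ _ _ _ p) // => /eqP->.
  by rewrite nth_mem_Inv_take // size_tuple.
move: hq; rewrite (@is_heap_eltE _ _ _ _ _ p) // => /eqP->.
by rewrite nth_mem_Inv_take ?size_tuple // ltnS -ltnNge.
Qed.

(** * Inversion sets of prefixes are the ideals of the heap *)

Section CommutationClass.

Variables (n : nat) (w : 'S_n) (C : {set #|Inv w|.-tuple 'I_n.-1}).
Variable i : #|Inv w|.-tuple 'I_n.-1.
Hypotheses (hC : C \in comm_classes w) (hi : i \in C).

Lemma class_equiv i' : i' \in C -> comm_equiv i' i.
Proof.
have csym := sym_connect_sym (@comm_step_sym n #|Inv w|).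
case/imsetP: hC hi => i0 _ ->; rewrite !inE => ci ci'.
by apply: connect_comm_equiv; rewrite csym in ci'; apply: connect_trans ci' ci.
Qed.

Lemma class_word_perm i' : i' \in C -> word_perm i' = w.
Proof.
case/imsetP: hC => i0; rewrite inE => /eqP ew ->; rewrite inE.
by move/connect_comm_equiv/(run_comm_equiv 1%g) => e; apply: etrans ew; apply: esym.
Qed.

Lemma class_ascending i' : i' \in C -> all (@ascending n) (trace 1%g i').
Proof. by move/class_word_perm; apply: reduced_ascending. Qed.

Lemma take_Pre i' m : i' \in C -> m <= #|Inv w| -> word_perm (take m i') \in Pre C.
Proof.
move=> hi' le_m; apply/imset2P.
by exists i' (Ordinal (le_m : m < #|Inv w|.+1)).
Qed.

Lemma Inv_Pre_sub u : u \in Pre C -> Inv u \subset Inv w.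
Proof.
case/imset2P=> i' m hi' _ ->; apply/subsetP=> p.
rewrite mem_Inv_take ?class_ascending // => /mem_take.
by rewrite -mem_Inv_word ?class_ascending // class_word_perm.
Qed.

(** [u] is a prefix of some word [i'] of [C]. In the trace of [i'] the inversions of [u] form an
    initial segment, which is clearly closed; closure is then carried from [i'] to [i] by
    commutations. *)
Lemma Inv_Pre_closed u p q :
  u \in Pre C -> heap_gen i p q -> q \in Inv u -> p \in Inv u.
Proof.
case/imset2P=> i' m hi' _ eu; move: p q.
have asc := class_ascending hi'.
apply/(heap_genP (mem (Inv u))); first exact: class_ascending.
apply: (heap_closed_equiv (class_equiv hi')).
case et: (trace 1%g i') => [//|x0 t]; rewrite -et.
apply/(pairwiseP x0) => j k; rewrite !inE size_trace => lt_j lt_k lt_jk.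
rewrite /heap_closed; apply/implyP=> _; apply/implyP.
rewrite -!(nth_map x0 x0.2) ?size_trace // eu /= !nth_mem_Inv_take //.
exact: ltn_trans.
Qed.

Lemma ideal_Inv_Pre I : heap_ideal i I -> exists2 u, u \in Pre C & Inv u = I.
Proof.
case=> /subsetP sub closed; have asc := class_ascending hi.
have /heap_closed_partition [s' equiv ts'] :
    pairwise (heap_closed (mem I)) (trace 1%g i).
  by apply/heap_genP => // p q pq; apply: closed; apply: t_step.
have [i' es' ci'] := comm_equiv_connect equiv (erefl _).
have hi' : i' \in C.
  by case/imsetP: hC hi => i0 _ ->; rewrite !inE => ci; apply: connect_trans ci ci'.
(* In the sorted word [i'] the elements of [I] come first, so the wanted prefix has length
   [size t1]. *)
rewrite {}es' in ts' equiv; set t1 := filter _ _ in ts'.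
exists (word_perm (take (size t1) i')).
  apply: take_Pre => //; rewrite -(size_tuple i) -(size_trace 1%g) size_filter.
  exact: count_size.
apply/setP=> p; rewrite mem_Inv_take ?class_ascending //.
rewrite -map_take ts' take_size_cat //.
apply/mapP/idP=> [[x]|pI]; first by rewrite mem_filter => /andP[xI _] ->.
(* As [I] lies in [Inv w], each of its elements does occur in the trace of [i]. *)
have : p \in Inv (word_perm i) by rewrite class_word_perm // sub.
rewrite mem_Inv_word // => /mapP[x xt ep].
by exists x; rewrite // mem_filter /= -ep pI.
Qed.

(** * Tallies, thresholds and the majority relation *)

Variable rho : 'S_n -> nat.
Hypothesis hrho : supp rho = Pre C.

Lemma rho_gt0 u : (0 < rho u) = (u \in Pre C).
Proof. by rewrite -hrho inE. Qed.

Lemma w_Pre : w \in Pre C.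
Proof.
have := take_Pre hi (leqnn _).
by rewrite -[X in take X](size_tuple i) take_size class_word_perm.
Qed.

Lemma tally_gt0 p : p \in Inv w -> 1 <= tally C rho p.
Proof.
move=> pw; rewrite /tally (bigD1 w) /=; last by rewrite w_Pre.
by rewrite addn_gt0 rho_gt0 w_Pre.
Qed.

Lemma tally_gen p q : heap_gen i p q -> tally C rho q < tally C rho p.
Proof.
move=> pq; have [j pj qj] := heap_gen_lt (class_ascending hi) pq.
have uPre : word_perm (take j.+1 i) \in Pre C by apply: take_Pre.
(* The positive vote of the prefix inverting [p] but not [q] is split off the tally of [p]; by
   [Inv_Pre_closed] the remaining sum still bounds the tally of [q] term by term. *)
rewrite /tally [X in _ < X](bigD1 (word_perm (take j.+1 i))) ?uPre //=.
rewrite -[X in X < _]add0n -addSn leq_add ?rho_gt0 //.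
rewrite big_mkcond [X in _ <= X]big_mkcond; apply: leq_sum => u _.
case: ifP => // /andP[uP qu]; rewrite uP (Inv_Pre_closed uP pq qu) /=.
by case: eqP => // eu; rewrite -eu qu in qj.
Qed.

Lemma tally_lt p q : heap_lt i p q -> tally C rho q < tally C rho p.
Proof.
elim=> {p q} [p q|p q r _ qp _ rq]; [exact: tally_gen | exact: ltn_trans rq qp].
Qed.

Lemma heap_lt_Inv p q : heap_lt i p q -> p \in Inv w.
Proof.
elim=> // {}p {}q /(heap_gen_lt (class_ascending hi))[j pj _].
by apply: (subsetP (Inv_Pre_sub _)) pj; apply: take_Pre.
Qed.

Lemma above_half_ideal : heap_ideal i (above_half C rho).
Proof.
split=> [|p q pq]; first by apply/subsetP=> p; rewrite in_set => /andP[].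
rewrite [q \in _]in_set [p \in _]in_set (heap_lt_Inv pq) => /andP[_ lt_q].
by apply: ltn_trans lt_q _; rewrite ltn_pmul2l // tally_lt.
Qed.

Lemma at_least_half_ideal : heap_ideal i (at_least_half C rho).
Proof.
split=> [|p q pq]; first by apply/subsetP=> p; rewrite in_set => /andP[].
rewrite [q \in _]in_set [p \in _]in_set (heap_lt_Inv pq) => /andP[_ le_q].
by apply: leq_trans le_q _; rewrite leq_pmul2l // ltnW // tally_lt.
Qed.

(** Permutations outside [Pre C] receive no votes, so restricting the sum to [Pre C] loses
    nothing. *)
Lemma votes_against (a b : 'I_n) : a < b ->
  \sum_(u | wlt u b a) rho u = tally C rho (a, b).
Proof.
move=> ab; rewrite /tally big_mkcond [RHS]big_mkcond; apply: eq_bigr => u _.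
rewrite mem_Inv_wlt // -rho_gt0; case: ifP => _; last by rewrite andbF.
by rewrite andbT; case: posnP.
Qed.

Lemma votes_for (a b : 'I_n) : a < b ->
  \sum_(u | wlt u a b) rho u + tally C rho (a, b) = total_votes rho.
Proof.
move=> ab; rewrite -votes_against // /total_votes [RHS](bigID (fun u => wlt u a b)) /=.
congr (_ + _); apply: eq_bigl => u.
by rewrite [wlt u a b]wlt_asym ?negbK // -val_eqE ltn_eqF.
Qed.

Lemma tally_notin p : p \notin Inv w -> tally C rho p = 0.
Proof.
move=> pw; rewrite /tally big_pred0 // => u; apply/negbTE.
by apply: contra pw => /andP[/Inv_Pre_sub/subsetP sub /sub].
Qed.

(** Ensures that a pair outside [Inv w], having tally 0, fails the weak threshold as well as the
    strict one. *)
Lemma total_votes_gt0 : 0 < total_votes rho.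
Proof. by rewrite /total_votes (bigD1 w) //= addn_gt0 rho_gt0 w_Pre. Qed.

(** Let [a < b] have tally [t] out of [N] votes. If [2t < N], both [u] and [v] place [a] first; if
    [2t > N], both place [b] first; in a tie only [v] inverts the pair, so the intersection leaves
    it incomparable. *)
Lemma majority_half u v :
  Inv u = above_half C rho -> Inv v = at_least_half C rho ->
  majority rho = linear_order u :&: linear_order v.
Proof.
move=> eu ev; have tot := total_votes_gt0.
have wu (a b : 'I_n) : a < b ->
    wlt u b a = (total_votes rho < 2 * tally C rho (a, b)).
  move=> ab; rewrite -mem_Inv_wlt // eu in_set.
  by case: (boolP (_ \in Inv w)) => // /tally_notin ->; rewrite muln0.
have wv (a b : 'I_n) : a < b ->
    wlt v b a = (total_votes rho <= 2 * tally C rho (a, b)).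
  move=> ab; rewrite -mem_Inv_wlt // ev in_set.
  by case: (boolP (_ \in Inv w)) => // /tally_notin ->; rewrite muln0 leqNgt tot.
apply/setP=> -[a b]; rewrite !inE /=.
case: (ltngtP a b) => [ab|ba|/val_inj->]; last by rewrite ltnn !wlt_irr.
  have ne : a != b by rewrite -val_eqE ltn_eqF.
  rewrite (wlt_asym u ne) (wlt_asym v ne) wu // wv // votes_against //.
  move: (votes_for ab); move: (tally _ _ _) (total_votes _) (bigop _ _ _); lia.
rewrite wu // wv // (votes_against ba).
move: (votes_for ba); move: (tally _ _ _) (total_votes _) (bigop _ _ _); lia.
Qed.

End CommutationClass.

Theorem theorem1p7 (n : nat) (w : 'S_n) (C : {set #|Inv w|.-tuple 'I_n.-1})
    (hC : C \in comm_classes w)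
    (i : #|Inv w|.-tuple 'I_n.-1) (hi : i \in C)
    (rho : 'S_n -> nat) (hrho : supp rho = Pre C) :
  [/\ forall p, p \in Inv w -> 1 <= tally C rho p,
      forall p q, heap_lt i p q -> tally C rho q < tally C rho p,
      heap_ideal i (above_half C rho),
      heap_ideal i (at_least_half C rho)
    & exists u v : 'S_n,
        [/\ unique (fun x => x \in Pre C /\ Inv x = above_half C rho) u,
            unique (fun x => x \in Pre C /\ Inv x = at_least_half C rho) v
          & majority rho = linear_order u :&: linear_order v]].
Proof.
have above := above_half_ideal hC hi hrho.
have at_least := at_least_half_ideal hC hi hrho.
split=> // [p|p q|].
- exact: (tally_gt0 hC hi hrho).
- exact: (tally_lt hC hi hrho).
have [u uP eu] := ideal_Inv_Pre hC hi above.
have [v vP ev] := ideal_Inv_Pre hC hi at_least.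
exists u, v; split; last exact: (majority_half hC hi hrho eu ev).
- by split=> // x [_ ex]; apply: Inv_inj; rewrite eu ex.
- by split=> // x [_ ex]; apply: Inv_inj; rewrite ev ex.
Qed.
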